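(* Let $G$ be a hereditarily countably characteristically based profinite group with $\mathrm{VZ}(G)=\{1\}$, and assume that $G$ is not $\mathrm{Aut}_2$. Then $G$ does not have a compactly generated topologically simple rigid envelope.
   Context: For a topological group $L$, $\mathrm{VZ}(L)=\{g\in L: \text{the centralizer of } g \text{ in } L \text{ is open}\}$. A profinite group is countably characteristically based if it has a countable base of neighborhoods of $1$ consisting of (topologically) characteristic open subgroups, and hereditarily countably characteristically based if every open subgroup is countably characteristically based. For a profinite group $U$, $\mathrm{Aut}(U)$ is the group of continuous automorphisms, with the standard topology: a base of neighborhoods of $1$ is given by the sets $A(O)=\{\gamma\in\mathrm{Aut}(U):\gamma(g)\equiv g \bmod O \text{ for all } g\in U\}$, $O$ an open subgroup of $U$. $\mathrm{TAut}(U)$ is the subgroup of those automorphisms which fix pointwise some open subgroup of $U$. Commensurator of a profinite group $G$: a virtual automorphism of $G$ is a topological isomorphism between two open subgroups of $G$; two are equivalent if they coincide on some open subgroup; the equivalence classes form, under composition (after restricting to suitable open subgroups), a group $\mathrm{Comm}(G)$. For an open subgroup $U$ of $G$, the homomorphism $\rho_U:\mathrm{Aut}(U)\to\mathrm{Comm}(G)$ sends an automorphism to its class; its kernel is $\mathrm{TAut}(U)$, and its image $\underline{\mathrm{Aut}}(U)\cong\mathrm{Aut}(U)/\mathrm{TAut}(U)$ carries the quotient topology. $G$ is $\mathrm{Aut}_1$ if $\mathrm{TAut}(U)$ is closed in $\mathrm{Aut}(U)$ for every open subgroup $U$ of $G$. For open subgroups $V\subseteq U$ of $G$, let $\mathrm{Aut}(U)_V=\{\alpha\in\mathrm{Aut}(U):\alpha(V)=V\}$,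 and let $\underline{\mathrm{Aut}}(U)_V=\rho_U(\mathrm{Aut}(U)_V)\subseteq\underline{\mathrm{Aut}}(V)$. An open subgroup $U$ of $G$ is $\mathrm{Aut}$-stable if $\underline{\mathrm{Aut}}(U)_V$ is open in $\underline{\mathrm{Aut}}(V)$ for every open subgroup $V$ of $U$. $G$ is $\mathrm{Aut}_2$ if $G$ is $\mathrm{Aut}_1$ and some open subgroup of $G$ is $\mathrm{Aut}$-stable. An envelope of a profinite group $G$ is a pair $(L,\eta)$ where $L$ is a topological group and $\eta:G\to L$ is an injective homomorphism such that $\eta(G)$ is open in $L$ and $\eta$ is a homeomorphism onto $\eta(G)$ (so $L$ is totally disconnected locally compact); adjectives applied to the envelope refer to $L$. Compactly generated: generated by a compact subset. Topologically simple: non-trivial, with no closed normal subgroups other than $\{1\}$ and itself. Rigid: for every topological isomorphism $\phi:U\to V$ between open compact subgroups of $L$ there exists a unique continuous automorphism $\phi_\circ\in\mathrm{Aut}(L)$ with $\phi_\circ|_U=\phi$. *)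

(* Defs.v *)
From HB Require Import structures.
From mathcomp Require Import all_boot all_classical topology.

Set Warnings "-redundant-canonical-projection,-projection-no-head-constant".
Set Implicit Arguments.
Unset Strict Implicit.
Unset Printing Implicit Defensive.

Local Open Scope classical_set_scope.
Local Open Scope group_scope.
Local Open Scope quotient_scope.

HB.structure Definition PreTopologicalGroup := {G of Topological G & Group G}.

HB.mixin Record PreTopologicalGroup_isTopologicalGroup G
    & PreTopologicalGroup G := {
  mulg_continuous : continuous (fun x : G * G => x.1 * x.2) ;
  invg_continuous : continuous (fun x : G => x^-1)
}.

#[short(type="topGroupType")]
HB.structure Definition TopologicalGroup :=
  {G of PreTopologicalGroup G & PreTopologicalGroup_isTopologicalGroup G}.

Definition is_subgroup (G : topGroupType) (H : set G) : Prop :=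
  group_closed (mem H).

Record openSubgroup (G : topGroupType) := OpenSubgroup {
  osg : set G ;
  osg_subgroup : is_subgroup osg ;
  osg_open : open osg
}.

Section OpenSubgroupTopGroup.
Context (G : topGroupType) (U : openSubgroup G).

Definition osg_sort : Type := set_type (osg U).

HB.instance Definition _ := SubChoice.on osg_sort.
HB.instance Definition _ := Topological.copy osg_sort (set_type (osg U)).
HB.instance Definition _ :=
  SubChoice_isSubGroup.Build G (mem (osg U)) osg_sort (osg_subgroup U).

Lemma osg_val_continuous : continuous (val : osg_sort -> G).
Proof. exact: initial_continuous. Qed.

Lemma osg_continuousP (T : topologicalType) (f : T -> osg_sort) :
  continuous (fun x => val (f x) : G) -> continuous f.
Proof.
move=> /continuousP cf; apply/continuousP => A [B oB <-].
exact: (cf B oB).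
Qed.

Lemma osg_mulg_continuous :
  continuous (fun x : osg_sort * osg_sort => x.1 * x.2).
Proof.
apply: osg_continuousP => x.
apply: (@continuous_comp _ _ _
  (fun x : osg_sort * osg_sort => (val x.1, val x.2) : G * G)
  (fun x : G * G => x.1 * x.2)); last exact: mulg_continuous.
apply: cvg_pair => /=.
  by apply: (continuous_comp cvg_fst); exact: osg_val_continuous.
by apply: (continuous_comp cvg_snd); exact: osg_val_continuous.
Qed.

Lemma osg_invg_continuous : continuous (fun x : osg_sort => x^-1).
Proof.
apply: osg_continuousP => x.
apply: (@continuous_comp _ _ _ (val : osg_sort -> G) (fun x : G => x^-1)).
  exact: osg_val_continuous.
exact: invg_continuous.
Qed.

HB.instance Definition _ :=
  PreTopologicalGroup_isTopologicalGroup.Build osg_sort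
    osg_mulg_continuous osg_invg_continuous.

Definition osg_topGroup : topGroupType := osg_sort.

End OpenSubgroupTopGroup.

Coercion osg_topGroup : openSubgroup >-> topGroupType.

Lemma is_subgroupE (G : topGroupType) (H : set G) :
  is_subgroup H <-> H 1 /\ forall x y, H x -> H y -> H (x * y^-1).
Proof.
split=> [[/set_mem H1 HV]|[H1 HV]]; split=> //.
- by move=> x y /mem_set Hx /mem_set Hy; apply/set_mem; exact: HV.
- exact/mem_set.
- by move=> x y /set_mem Hx /set_mem Hy; apply/mem_set; exact: HV.
Qed.

Section OpenSubgroupTheory.
Context (G : topGroupType).
Implicit Types O : openSubgroup G.

Lemma osg1 O : osg O 1.
Proof. by have /is_subgroupE[] := osg_subgroup O. Qed.

Lemma osgV O x : osg O x -> osg O x^-1.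
Proof.
have /is_subgroupE[O1 OV] := osg_subgroup O.
by move=> Ox; rewrite -[x^-1]mul1g; exact: OV.
Qed.

Lemma osgM O x y : osg O x -> osg O y -> osg O (x * y).
Proof.
have /is_subgroupE[O1 OV] := osg_subgroup O.
by move=> Ox /osgV Oy; rewrite -[y]invgK; exact: OV.
Qed.

Program Definition osgT := @OpenSubgroup G [set: G] _ openT.
Next Obligation. by apply/is_subgroupE. Qed.

Program Definition osgI O1 O2 := @OpenSubgroup G (osg O1 `&` osg O2) _ _.
Next Obligation.
move=> O1 O2; apply/is_subgroupE; split; first by split; exact: osg1.
move=> x y [x1 x2] [y1 y2].
by split; apply: osgM => //; exact: osgV.
Qed.
Next Obligation. by move=> O1 O2; apply: openI; exact: osg_open. Qed.

End OpenSubgroupTheory.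

Definition profinite (G : topGroupType) : Prop :=
  [/\ compact [set: G], hausdorff_space G & totally_disconnected [set: G]].

Definition VZ (L : topGroupType) : set L :=
  [set g | open [set h : L | commute g h]].
Arguments VZ : clear implicits.

Record topIso (G H : topGroupType) := TopIso {
  tiso :> G -> H ;
  tiso_inv : H -> G ;
  tisoM : {morph tiso : x y / x * y} ;
  tisoK : cancel tiso tiso_inv ;
  tiso_invK : cancel tiso_inv tiso ;
  tiso_continuous : continuous tiso ;
  tiso_inv_continuous : continuous tiso_inv
}.

Lemma topIso_ext (G H : topGroupType) (f g : topIso G H) :
  (forall x, f x = g x) -> f = g.
Proof.
case: f g => [f fi fM fK fiK fc fic] [g gi gM gK giK gc gic] /= fg.
have {}fg : f = g by exact/funext.
subst g.
have fgi : fi = gi by apply/funext => y; rewrite -{1}[y]giK fK.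
subst gi.
by congr TopIso; exact: Prop_irrelevance.
Qed.

(* For a profinite (hence compact Hausdorff) group, the inverse of a continuous
   automorphism is automatically continuous. *)
Definition Aut (U : topGroupType) : Type := topIso U U.

Section AutGroup.
Context (U : topGroupType).
Implicit Types f g h : Aut U.

HB.instance Definition _ := gen_eqMixin (Aut U).
HB.instance Definition _ := gen_choiceMixin (Aut U).

Program Definition aut_one : Aut U := @TopIso U U id id _ _ _ _ _.
Next Obligation. by []. Qed.
Next Obligation. by []. Qed.
Next Obligation. by []. Qed.
Next Obligation. by move=> x; exact: cvg_id. Qed.
Next Obligation. by move=> x; exact: cvg_id. Qed.

Program Definition aut_inv f : Aut U := @TopIso U U (tiso_inv f) f _ _ _ _ _.
Next Obligation.
by move=> f x y; rewrite -[RHS](tisoK f) tisoM !tiso_invK.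
Qed.
Next Obligation. exact: tiso_invK. Qed.
Next Obligation. exact: tisoK. Qed.
Next Obligation. exact: tiso_inv_continuous. Qed.
Next Obligation. exact: tiso_continuous. Qed.

Program Definition aut_mul f g : Aut U :=
  @TopIso U U (f \o g) (tiso_inv g \o tiso_inv f) _ _ _ _ _.
Next Obligation. by move=> f g x y /=; rewrite !tisoM. Qed.
Next Obligation. by move=> f g x /=; rewrite !tisoK. Qed.
Next Obligation. by move=> f g x /=; rewrite !tiso_invK. Qed.
Next Obligation.
move=> f g x; apply: continuous_comp; exact: tiso_continuous.
Qed.
Next Obligation.
move=> f g x; apply: continuous_comp; exact: tiso_inv_continuous.
Qed.

Lemma aut_mulA : associative aut_mul.
Proof. by move=> f g h; exact: topIso_ext. Qed.
Lemma aut_mul1 : left_id aut_one aut_mul.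
Proof. by move=> f; exact: topIso_ext. Qed.
Lemma aut_mulr1 : right_id aut_one aut_mul.
Proof. by move=> f; exact: topIso_ext. Qed.
Lemma aut_mulV : left_inverse aut_one aut_inv aut_mul.
Proof. by move=> f; apply: topIso_ext => x /=; rewrite tisoK. Qed.
Lemma aut_mulrV : right_inverse aut_one aut_inv aut_mul.
Proof. by move=> f; apply: topIso_ext => x /=; rewrite tiso_invK. Qed.

HB.instance Definition _ := isGroup.Build (Aut U)
  aut_mulA aut_mul1 aut_mulr1 aut_mulV aut_mulrV.

Lemma autM f g x : (f * g) x = f (g x). Proof. by []. Qed.
Lemma aut1 x : (1 : Aut U) x = x. Proof. by []. Qed.
Lemma autK f : cancel f (f^-1)%g. Proof. exact: tisoK. Qed.
Lemma autVK f : cancel (f^-1)%g f. Proof. exact: tiso_invK. Qed.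

(* A(O) : the congruence is between left cosets of O. *)
Definition aut_congr (O : openSubgroup U) : set (Aut U) :=
  [set f : Aut U | forall g : U, osg O (g^-1 * f g)].

(* The topology in which the A(O) form a base of neighbourhoods of 1;
   see nbhs_autE, and the topGroupType instance below. *)
Definition aut_open (S : set (Aut U)) : Prop :=
  forall f, S f -> exists O : openSubgroup U,
    forall g, aut_congr O g -> S (g * f).

Lemma aut_congr1 (O : openSubgroup U) : aut_congr O 1.
Proof. by move=> x; rewrite aut1 mulVg; exact: osg1. Qed.

Lemma aut_congrM (O : openSubgroup U) f g :
  aut_congr O f -> aut_congr O g -> aut_congr O (f * g).
Proof.
move=> Of Og x; rewrite autM -[f (g x)](mulVKg (g x)) mulgA.
by apply: osgM; [exact: Og|exact: Of].
Qed.

Lemma aut_congrV (O : openSubgroup U) f : aut_congr O f -> aut_congr O f^-1.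
Proof.
move=> Of x; rewrite -[x in x^-1 * _](autVK f) -[_ * _]invgK invgM invgK.
by apply: osgV; exact: Of.
Qed.

Lemma aut_openT : aut_open setT.
Proof. by move=> f _; exists (osgT U). Qed.

Lemma aut_openI : setI_closed aut_open.
Proof.
move=> A B oA oB f [/oA[O1 h1] /oB[O2 h2]]; exists (osgI O1 O2) => g Og.
by split; [apply: h1 => x; have [] := Og x|apply: h2 => x; have [] := Og x].
Qed.

Lemma aut_open_bigU (I : Type) (F : I -> set (Aut U)) :
  (forall i, aut_open (F i)) -> aut_open (\bigcup_i F i).
Proof.
by move=> oF f [i _ /oF[O Oi]]; exists O => g /Oi ?; exists i.
Qed.

HB.instance Definition _ := isOpenTopological.Build (Aut U)
  aut_openT aut_openI aut_open_bigU.

Lemma nbhs_autE f (S : set (Aut U)) :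
  nbhs f S <-> exists O : openSubgroup U, forall g, aut_congr O g -> S (g * f).
Proof.
rewrite nbhsE; split=> [[B [oB Bf] BS]|[O OS]].
  by have [O OB] := oB f Bf; exists O => g /OB /BS.
exists [set g | aut_congr O (g * f^-1)].
  split; last by rewrite /= mulgV; exact: aut_congr1.
  by move=> g Og; exists O => h Oh /=; rewrite -mulgA; exact: aut_congrM.
by move=> g /OS; rewrite mulgVK.
Qed.

Program Definition osg_preimage f (O : openSubgroup U) :=
  @OpenSubgroup U (f @^-1` osg O) _ _.
Next Obligation.
move=> f O; apply/is_subgroupE.
have f1 : f 1 = 1 by apply: (mulgI (f 1)); rewrite -tisoM !mulg1.
have fV x : f x^-1 = (f x)^-1 by apply/esym/mulg1_eq; rewrite -tisoM mulgV.
split; first by rewrite /= f1; exact: osg1.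
by move=> x y Ox Oy; rewrite /= tisoM fV; apply: osgM => //; exact: osgV.
Qed.
Next Obligation.
by move=> f O; have /continuousP := @tiso_continuous _ _ f; apply; exact: osg_open.
Qed.

Lemma aut_congrJ f (O : openSubgroup U) g :
  aut_congr (osg_preimage f O) g -> aut_congr O (f * g * f^-1).
Proof.
move=> Og x; rewrite !autM.
have : osg O (f ((f^-1 x)^-1 * g (f^-1 x))) by exact: Og.
rewrite tisoM; have -> // : f (f^-1 x)^-1 = x^-1.
apply/esym/mulg1_eq; rewrite -[x in x * _](autVK f) -tisoM mulgV.
by apply: (mulgI (f 1)); rewrite -tisoM !mulg1.
Qed.

Lemma aut_mulg_continuous : continuous (fun x : Aut U * Aut U => x.1 * x.2).
Proof.
case=> f g S /= /nbhs_autE[O OS].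
exists ([set f' | aut_congr O (f' * f^-1)],
        [set g' | aut_congr (osg_preimage f O) (g' * g^-1)]) => /=.
  split; apply/nbhs_autE; eexists => h Oh /=; rewrite mulgK; exact: Oh.
move=> [f' g'] /= [Of /aut_congrJ Og].
have := OS _ (aut_congrM Of Og).
by rewrite !mulgA !mulgVK.
Qed.

Lemma aut_invg_continuous : continuous (fun x : Aut U => x^-1).
Proof.
move=> f S /= /nbhs_autE[O OS]; apply/nbhs_autE.
exists (osg_preimage f^-1 O) => g /aut_congrV/aut_congrJ/OS /=.
by rewrite invgM invgK mulgK.
Qed.

HB.instance Definition _ :=
  PreTopologicalGroup_isTopologicalGroup.Build (Aut U)
    aut_mulg_continuous aut_invg_continuous.

End AutGroup.

Definition TAut (U : topGroupType) : set (Aut U) :=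
  [set f : Aut U | exists O : openSubgroup U, forall x : U, osg O x -> f x = x].
Arguments TAut : clear implicits.

Definition characteristic (U : topGroupType) (N : set U) : Prop :=
  forall f : Aut U, f @` N = N.

Definition countably_char_based (U : topGroupType) : Prop :=
  exists B : set (openSubgroup U),
    [/\ countable B,
        forall N, B N -> characteristic (osg N) &
        forall A : set U, nbhs 1 A -> exists2 N, B N & osg N `<=` A].

Definition hereditarily_countably_char_based (G : topGroupType) : Prop :=
  forall U : openSubgroup G, countably_char_based U.

Section Commensurator.
Context (G : topGroupType).

Record virtAut := VirtAut {
  vdom : openSubgroup G ;
  vcod : openSubgroup G ;
  viso :> topIso vdom vcod
}.

HB.instance Definition _ := gen_eqMixin virtAut.
HB.instance Definition _ := gen_choiceMixin virtAut.

Definition coincide_on (W : openSubgroup G) (f g : virtAut) : Prop :=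
  [/\ osg W `<=` osg (vdom f), osg W `<=` osg (vdom g) &
      forall (x : vdom f) (y : vdom g), osg W (val x) ->
        val x = val y :> G -> val (f x) = val (g y) :> G].

Definition virtAut_equiv (f g : virtAut) : bool :=
  `[< exists W : openSubgroup G, coincide_on W f g >].

Lemma virtAut_equiv_refl : reflexive virtAut_equiv.
Proof.
move=> f; apply/asboolP; exists (vdom f); split=> // x y _ xy.
by congr (val (f _)); exact: val_inj.
Qed.

Lemma virtAut_equiv_sym : symmetric virtAut_equiv.
Proof.
suff H f g : virtAut_equiv f g -> virtAut_equiv g f.
  by move=> f g; apply/idP/idP; exact: H.
move=> /asboolP[W [Wf Wg fg]]; apply/asboolP; exists W; split=> // x y Wx xy.
by apply/esym/fg => //; rewrite -xy.
Qed.

Lemma virtAut_equiv_trans : transitive virtAut_equiv.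
Proof.
move=> g f h /asboolP[W1 [W1f W1g fg]] /asboolP[W2 [W2g W2h gh]].
apply/asboolP; exists (osgI W1 W2); split=> [x [/W1f]//|x [_ /W2h]//|].
move=> x y [W1x W2x] xy.
pose z : vdom g := exist _ (val x) (mem_set (W1g _ W1x)).
by rewrite (fg x z)// (gh z y).
Qed.

Canonical virtAut_equiv_rel := EquivRel virtAut_equiv
  virtAut_equiv_refl virtAut_equiv_sym virtAut_equiv_trans.

Definition Comm : Type := {eq_quot virtAut_equiv}.

HB.instance Definition _ := Choice.on Comm.
HB.instance Definition _ := EqQuotient.on Comm.

Implicit Types U V : openSubgroup G.

Definition rho U (f : Aut U) : Comm := \pi_Comm (@VirtAut U U f).
#[global] Arguments rho : clear implicits.

Definition uAut U : set Comm := range (rho U).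
#[global] Arguments uAut : clear implicits.

(* S is open in uAut U for the topology coinduced by rho U, which is the
   quotient topology of Aut U / TAut U transported to uAut U. *)
Definition uAut_open U (S : set Comm) : Prop :=
  S `<=` uAut U /\ open (rho U @^-1` S).

(* alpha(V) = V, where [val @^-1` V] is V seen as a subset of U. *)
Definition Aut_fix U V : set (Aut U) :=
  [set f : Aut U | let VU : set U := val @^-1` osg V in f @` VU = VU].
#[global] Arguments Aut_fix : clear implicits.

Definition uAut_fix U V : set Comm := rho U @` Aut_fix U V.
#[global] Arguments uAut_fix : clear implicits.

Definition Aut_stable U : Prop :=
  forall V, osg V `<=` osg U -> uAut_open V (uAut_fix U V).

Definition Aut1 : Prop := forall U, closed (TAut U).

Definition Aut2 : Prop := Aut1 /\ exists U, Aut_stable U.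

End Commensurator.

Record envelope (G : topGroupType) := Envelope {
  env :> topGroupType ;
  env_map : G -> env ;
  env_mapM : {morph env_map : x y / x * y} ;
  env_map_inj : injective env_map ;
  env_map_open : open (range env_map) ;
  env_map_homeo : exists g : env -> G,
    [/\ cancel env_map g, continuous env_map &
        {within range env_map, continuous g}]
}.

Definition compactly_generated (L : topGroupType) : Prop :=
  exists2 K : set L, compact K &
    forall H : set L, is_subgroup H -> K `<=` H -> H = [set: L].

Definition normal_subgroup (L : topGroupType) (N : set L) : Prop :=
  is_subgroup N /\ forall x y : L, N x -> N (x ^ y).

Definition topologically_simple (L : topGroupType) : Prop :=
  (exists x : L, x <> 1) /\
  forall N : set L, closed N -> normal_subgroup N -> N = [set 1] \/ N = [set: L].

Definition rigid (L : topGroupType) : Prop :=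
  forall (U V : openSubgroup L) (phi : topIso U V),
    compact (osg U) -> compact (osg V) ->
    exists! psi : Aut L, forall x : U, psi (val x) = val (phi x) :> L.

(* Main.v *)
(* Suppose [L] is such an envelope; then every open subgroup [U] of [G] is
   Aut-stable. Let [V] be an open subgroup of [U]. By rigidity every [g] in
   [Aut V] extends to a unique automorphism [ext g] of [L]. For [x] in [L], the
   sets of those [g] with [ext g x] in a given coset [y V] are closed, and
   countably many of them cover [Aut V], because [L] is sigma-compact. As a base
   of characteristic subgroups makes [Aut V] compact, Baire's theorem shows that
   [ext g x] is in [x V] for all [g] close to [1]. As [U] is a finite union of
   cosets [x V], [ext g] then preserves [U] for all [g] close to [1]. *)
Require Import Defs.
From mathcomp Require Import all_boot all_classical topology.

Set Implicit Arguments.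
Unset Strict Implicit.
Unset Printing Implicit Defensive.

Local Open Scope classical_set_scope.
Local Open Scope group_scope.

(** * Units and inverses under homomorphisms *)

Section Homomorphism.
Context (G H : groupType) (f : G -> H) (fM : {morph f : x y / x * y}).

Lemma hom1 : f 1 = 1.
Proof. by apply: (mulgI (f 1)); rewrite -fM !mulg1. Qed.

Lemma homV x : f x^-1 = (f x)^-1.
Proof. by apply/esym/mulg1_eq; rewrite -fM mulgV hom1. Qed.

End Homomorphism.

(** * Topological groups and the normal subgroup [VZ] *)

Section TopologicalGroup.
Context (G : topGroupType).

Lemma continuous_mulg (T : topologicalType) (f g : T -> G) :
  continuous f -> continuous g -> continuous (fun x => f x * g x).
Proof.
move=> cf cg x.
apply: (@continuous_comp _ _ _ (fun x => (f x, g x)) (fun y => y.1 * y.2)).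
  by apply: cvg_pair; [exact: cf|exact: cg].
exact: mulg_continuous.
Qed.

Lemma continuous_invg (T : topologicalType) (f : T -> G) :
  continuous f -> continuous (fun x => (f x)^-1).
Proof.
by move=> cf x; apply: continuous_comp; [exact: cf|exact: invg_continuous].
Qed.

Lemma continuous_id : continuous (@id G).
Proof. by move=> x; exact: cvg_id. Qed.

Lemma continuous_lmulg (a : G) : continuous (fun x => a * x).
Proof. by apply: continuous_mulg; [exact: cst_continuous|exact: continuous_id]. Qed.

Lemma nbhs_lmulg (a x : G) (A : set G) :
  nbhs x A -> nbhs (a * x) [set a * y | y in A].
Proof.
move=> xA; have : nbhs (a * x) ((fun y => a^-1 * y) @^-1` A).
  by apply: continuous_lmulg; rewrite mulKg.
by apply: filterS => y Ay; exists (a^-1 * y) => //; rewrite mulVKg.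
Qed.

Lemma is_subgroup_open (H A : set G) :
  is_subgroup H -> nbhs 1 A -> A `<=` H -> open H.
Proof.
move=> /is_subgroupE[H1 HV] A1 AH; rewrite openE => x Hx.
have := nbhs_lmulg x A1; rewrite mulg1; apply: filterS => _ [y Ay <-].
rewrite -[y]invgK; apply: (HV) => //; rewrite -[y^-1]mul1g.
by apply: HV => //; exact: AH.
Qed.

Lemma centralizer_subgroup (g : G) : is_subgroup [set h | commute g h].
Proof.
apply/is_subgroupE; split; first exact: commute1.
by move=> x y gx gy; apply: commuteM => //; exact: commuteV.
Qed.

(** A centralizer is a subgroup, hence open as soon as it contains a neighbourhood of $1$; only such
    a neighbourhood has to be exhibited below. *)
Lemma VZP (g : G) : (exists2 A, nbhs 1 A & A `<=` commute g) <-> VZ G g.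
Proof.
split=> [[A A1 Ag]|og]; first exact: is_subgroup_open (centralizer_subgroup g) A1 Ag.
exists (commute g) => //; rewrite nbhsE.
by exists [set h | commute g h] => //; split=> //; exact: commute1.
Qed.

Lemma osg_nbhs1 (O : openSubgroup G) : nbhs 1 (osg O).
Proof. by rewrite nbhsE; exists (osg O) => //; split; [exact: osg_open|exact: osg1]. Qed.

Lemma VZ_normal : normal_subgroup (VZ G).
Proof.
split; first apply/is_subgroupE.
  split; first by apply/VZP; exists setT; [exact: filterT|move=> x _; exact/commute_sym/commute1].
  move=> x y /VZP[A A1 Ax] /VZP[B B1 By]; apply/VZP; exists (A `&` B).
    exact: filterI.
  move=> z [/Ax xz /By yz]; apply: commute_sym.
  by apply: commuteM; [|apply: commuteV]; exact: commute_sym.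
move=> x y /VZP[A A1 Ax]; apply/VZP.
exists ((fun z => y * z * y^-1) @^-1` A).
  have cJ : continuous (fun z => y * z * y^-1).
    by apply: continuous_mulg; [exact: continuous_lmulg|exact: cst_continuous].
  by apply: cJ; rewrite mulg1 mulgV.
move=> z /= /Ax; rewrite /commute conjgE => xz.
apply: (mulgI y); apply: (mulIg y^-1).
by move: xz; rewrite !mulgA mulgV mul1g !mulgK.
Qed.

End TopologicalGroup.

(** * Open embeddings of topological groups *)

Section OpenEmbedding.
Context (G L : topGroupType).

(** One notion covers the envelope map, the inclusions between open subgroups and their
    composites. *)
Record open_embedding (e : G -> L) : Prop := OpenEmbedding {
  embM : {morph e : x y / x * y} ;
  emb_inj : injective e ;
  emb_continuous : continuous e ;
  emb_nbhs : forall x A, nbhs x A -> nbhs (e x) (e @` A)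
}.

Context (e : G -> L) (he : open_embedding e).

Lemma emb_open (A : set G) : open A -> open (e @` A).
Proof.
rewrite openE => oA; rewrite openE => _ [x Ax <-].
by apply: (emb_nbhs he); exact: oA.
Qed.

Lemma emb_lift (x : L) : range e x -> exists y, e y = x.
Proof. by case=> y _ <-; exists y. Qed.

Lemma emb_continuousP (T : topologicalType) (f : T -> G) :
  continuous (e \o f) -> continuous f.
move=> cf x A /(emb_nbhs he) eA; 
have : nbhs x ((e \o f) @^-1` (e @` A)) by exact: cf.
apply: filterS => z.
by move=> /= [y Ay /(emb_inj he) <-].
Qed.

Lemma emb_coset_nbhs (x : L) (A : set G) :
  nbhs 1 A -> nbhs x [set x * e v | v in A].
Proof.
move=> /(emb_nbhs he)/(nbhs_lmulg x); rewrite (hom1 (embM he)) mulg1.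
by apply: filterS => _ [_ [v Av <-] <-]; exists v.
Qed.

(** If [p] and [q] cannot be separated, their cosets of the range meet, so [p = q * e c].
    Translation by [q] then turns the question into the separation of $1$ and [c] in [G]. *)
Lemma emb_hausdorff : hausdorff_space G -> hausdorff_space L.
Proof.
move=> hG p q pq.
have [_ [[a _ <-] [b _ eb]]] := pq _ _ (emb_coset_nbhs p filterT)
  (emb_coset_nbhs q filterT).
have pE : p = q * e (b * a^-1).
  by rewrite (embM he) (homV (embM he)) mulgA eb mulgK.
suff c1 : 1 = b * a^-1 by rewrite pE -c1 (hom1 (embM he)) mulg1.
apply: hG => A B A1 Bc.
have Aq : nbhs q [set q * e v | v in A] by exact: emb_coset_nbhs.
have Bp : nbhs p [set q * e v | v in B].
  rewrite pE; have := nbhs_lmulg q (emb_nbhs he Bc).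
  by apply: filterS => _ [_ [v Bv <-] <-]; exists v.
have [_ [[v Bv <-] [w Aw /mulgI/(emb_inj he) wv]]] := pq _ _ Bp Aq.
by exists v; split=> //; rewrite -wv.
Qed.

Lemma VZ_emb g : VZ L (e g) -> VZ G g.
Proof.
move=> /VZP[A A1 Ag]; apply/VZP; exists (e @^-1` A).
  by apply: (emb_continuous he); rewrite (hom1 (embM he)).
by move=> h /Ag; rewrite /commute /= -!(embM he) => /(emb_inj he).
Qed.

(** If [y] and [z] in [VZ L] lie in the same coset of the range at [x], then $yz^{-1}$ conjugated by
    [x] is in the range and in [VZ L], hence trivial by [VZ_emb]. So every point has a neighbourhood
    with at most one element of [VZ L]. *)
Lemma VZ_emb_closed : hausdorff_space G -> VZ G = [set 1] -> closed (VZ L).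
Proof.
move=> hG GVZ x clx.
have hL : hausdorff_space L by exact: emb_hausdorff.
pose A := [set x * e v | v in [set: G]].
have xA : nbhs x A by apply: emb_coset_nbhs; exact: filterT.
have inter y z : A y -> A z -> VZ L y -> VZ L z -> y = z.
  move=> [v _ <-] [w _ <-] hy hz.
  have [/is_subgroupE[V1 VV] VJ] := VZ_normal L.
  have : VZ L ((e (v * w^-1))).
    have := VJ _ (x^-1) (VV _ _ hy hz); have := VJ _ x (VV _ _ hy hz).
    rewrite conjgE invgM !mulgA mulVg mul1g mulgVK => h _.
    by rewrite (embM he) (homV (embM he)).
  by move/VZ_emb; rewrite GVZ => /= /divg1_eq ->.
have [z [Vz Az]] := clx _ xA.
have [<-//|/eqP xz] := pselect (z = x); exfalso.
have : nbhs x (A `&` ~` [set z]).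
  apply: filterI => //; apply: open_nbhs_nbhs; split.
    by apply: closed_openC; exact/accessible_closed_set1/hausdorff_accessible.
  by move=> /= xz'; rewrite xz' eqxx in xz.
by move=> /clx[y [Vy [Ay]]]; apply; exact: inter.
Qed.

End OpenEmbedding.

(** * Compact spaces and Baire's theorem *)

Section Compactness.
Context (X : topologicalType).

Lemma compact_nbhs_cover (K : set X) (W : X -> set X) :
  compact K -> (forall x, K x -> nbhs x (W x)) ->
  exists s : seq X, forall y, K y -> exists2 x, x \in s & W x y.
Proof.
move=> /compact_near_coveringP cK KW.
(* Compactness is used as near-covering for the filter of finite sequences ordered by inclusion: a
   property holds near it if it holds for all sequences containing a fixed one. *)
pose F : set_system (seq X) :=
  filter_from setT (fun s0 : seq X => [set s : seq X | {subset s0 <= s}]).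
have FF : Filter F.
  apply: filter_from_filter; first by exists [::].
  move=> s t _ _; exists (s ++ t) => // u stu.
  by split=> x xs; apply: stu; rewrite mem_cat xs ?orbT.
have [x Kx|s _ sK] := cK _ F (fun s y => exists2 x, x \in s & W x y) FF.
  exists (W x, [set s | x \in s]); last first.
    by move=> [y s] /= [Wy xs]; exists x.
  split; first exact: KW.
  by exists [:: x] => // s; apply; rewrite mem_head.
by exists s => y Ky; exact: sK.
Qed.

(** Otherwise every point has a neighbourhood that misses [C n] for all large [n], and by
    compactness a single [C n] would be empty. *)
Lemma compact_bigcap_nonempty (C : nat -> set X) :
  compact [set: X] -> (forall n, closed (C n)) ->
  (forall n, C n.+1 `<=` C n) -> (forall n, C n !=set0) ->
  exists x, forall n, C n x.
Proof.
move=> /compact_near_coveringP cX cC decC C0.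
have {}decC m n : m <= n -> C n `<=` C m.
  by move=> /subnK<-; elim: (n - m) => // k IH x /decC /IH.
apply: contrapT => noC; have FF : Filter \oo by exact: _.
have [x _|n _ nC] := cX _ \oo (fun n y => ~ C n y) FF.
  have [n Cnx] : exists n, ~ C n x.
    apply: contrapT => H; apply: noC; exists x => n.
    by apply: contrapT => ?; apply: H; exists n.
  exists (~` C n, [set m | n <= m]); last first.
    by move=> [y m] /= [Cy nm] /(decC _ _ nm).
  split; last by exists n.
  by apply: open_nbhs_nbhs; split=> //; exact: closed_openC.
have [x Cx] := C0 n.
by apply: (nC n) Cx => //=; exact: leqnn.
Qed.

(** If all [F n] had empty interior, any set with nonempty interior could be shrunk, by regularity,
    to a closed one with nonempty interior that avoids [F n]. Iterating gives nested closed sets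
    whose common point lies in no [F n]. *)
Lemma compact_baire (F : nat -> set X) :
  compact [set: X] -> hausdorff_space X -> [set: X] !=set0 ->
  (forall n, closed (F n)) -> (forall x, exists n, F n x) ->
  exists n, (F n)° !=set0.
Proof.
move=> cX hX X0 cF Fcov; apply: contrapT => noint.
(* The implication makes the choice total: for a set with empty interior any value will do. *)
have /choice[step stepP] (nC : nat * set X) : exists D : set X, nC.2° !=set0 ->
    [/\ closed D, D° !=set0, D `<=` nC.2 & D `<=` ~` F nC.1].
  case: nC => n C /=; have [[c Cc]|] := pselect (C° !=set0); last by exists C.
  have [x [Cx Fx]] : exists x, C° x /\ ~ F n x.
    apply: contrapT => H; apply: noint; exists n, c.
    apply: filterS (nbhs_interior Cc) => y Cy.
    by apply: contrapT => ?; apply: H; exists y.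
  have /(compact_regular hX cX filterT)[B xB BCF] : nbhs x (C `&` ~` F n).
    apply: filterI => //; apply: open_nbhs_nbhs; split=> //.
    exact: closed_openC.
  exists (closure B); split=> [||y /BCF[]//|y /BCF[]//].
    exact: closed_closure.
  by exists x; apply: filterS xB; exact: subset_closure.
(* The set that avoids [F n] is [C n.+1]. *)
pose C := fix C n := if n is m.+1 then step (m, C m) else [set: X].
have C0 n : (C n)° !=set0.
  elim: n => [|n IH]; first by have [x _] := X0; exists x; exact: filterT.
  by have [] := stepP (n, C n) IH.
have [x Cx] : exists x, forall n, C n x.
  apply: compact_bigcap_nonempty => // [[|n]|n|n].
  - exact: closedT.
  - by have [] := stepP (n, C n) (C0 n).
  - by have [] := stepP (n, C n) (C0 n).
  - by have [x /nbhs_singleton] := C0 n; exists x.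
have [n Fx] := Fcov x.
by have [_ _ _ /(_ x (Cx n.+1))] := stepP (n, C n) (C0 n).
Qed.

Lemma ultra_map_cvg (T : Type) (F : set_system T) (f : T -> X) :
  compact [set: X] -> UltraFilter F -> exists p : X, f x @[x --> F] --> p.
Proof.
move=> cX FU; have FF : ProperFilter F by exact: ultra_proper.
have [p [_ clp]] := cX _ (fmap_proper_filter f FF) filterT.
exists p => A pA; have [//|FnA] := in_ultra_setVsetC (f @^-1` A) FU.
by have [y [nAy /nAy]] := clp (~` A) A FnA pA.
Qed.

End Compactness.

(** * Compactness of the automorphism group *)

Section AutCompact.
Context (V : topGroupType).

Definition char_based :=
  forall A : set V, nbhs 1 A ->
    exists2 N : openSubgroup V, characteristic (osg N) & osg N `<=` A.

Lemma countably_char_based_char_based : countably_char_based V -> char_based.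
Proof.
move=> [B [_ Bchar Bbase]] A /Bbase[N BN NA]; exists N => //; exact: Bchar.
Qed.

Lemma osg_closed (O : openSubgroup V) : closed (osg O).
Proof.
move=> x clx; have := nbhs_lmulg x (osg_nbhs1 O).
rewrite mulg1 => /clx[z [Oz [y Oy xy]]]; rewrite -[x](mulgK y) xy.
by apply: osgM => //; exact: osgV.
Qed.

Context (cV : compact [set: V]) (hV : hausdorff_space V) (bV : char_based).

Lemma char_basedP (x : V) :
  (forall N : openSubgroup V, characteristic (osg N) -> osg N x) -> x = 1.
Proof.
move=> Nx; apply/esym/hV => A B A1 Bx.
have [N Nchar NA] := bV A1.
by exists x; split; [exact/NA/Nx|exact: nbhs_singleton].
Qed.

Lemma continuous_eval (x : V) : continuous (fun f : Aut V => f x).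
Proof.
move=> f A /= fA.
have /bV[N Nchar NA] : nbhs 1 ((fun y => f x * y) @^-1` A).
  by apply: continuous_lmulg; rewrite mulg1.
apply/nbhs_autE; exists N => g Ng /=.
rewrite -[g (f x)](mulVKg (f x)); apply: NA; exact: Ng.
Qed.

Lemma Aut_hausdorff : hausdorff_space (Aut V).
Proof.
move=> p q pq; apply: topIso_ext => x; apply: hV => A B pA qB.
have [f [Af Bf]] := pq _ _ (continuous_eval pA) (continuous_eval qB).
by exists (f x).
Qed.

(** The map [a] will be the identity or inversion, so that the limits of $f$ and of $f^{-1}$ are
    treated together. *)
Lemma aut_limit_morph (F : set_system (Aut V)) (a : Aut V -> Aut V) (phi : V -> V) :
  ProperFilter F -> (forall x, a f x @[f --> F] --> phi x) ->
  {morph phi : x y / x * y}.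
Proof.
move=> FF cphi x y; apply: (cvg_unique hV (cphi (x * y))).
have : (a f x, a f y) @[f --> F] --> (phi x, phi y) by exact: cvg_pair.
move=> /cvg_comp/(_ (@mulg_continuous V (phi x, phi y))).
rewrite (_ : _ \o _ = fun f => a f (x * y))//.
by apply/funext => f /=; rewrite tisoM.
Qed.

(** Finitely many cosets [x N] cover [V]. Each [a f] maps [N] into itself, and so does [phi], as [N]
    is closed. Hence modulo [N] the values on [x N] are determined by the value at [x]. *)
Lemma aut_limit_uniform (F : set_system (Aut V)) (a : Aut V -> Aut V) (phi : V -> V)
    (N : openSubgroup V) :
  ProperFilter F -> (forall x, a f x @[f --> F] --> phi x) ->
  characteristic (osg N) -> \forall f \near F, forall x, osg N ((phi x)^-1 * a f x).
Proof.
move=> FF cphi Nchar.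
have phiM := aut_limit_morph FF cphi.
have [|s sP] := @compact_nbhs_cover V setT (fun x => [set x * n | n in osg N]) cV.
  by move=> x _; have := nbhs_lmulg x (osg_nbhs1 N); rewrite mulg1.
have aN f n : osg N n -> osg N (a f n).
  by move=> Nn; rewrite -(Nchar (a f)); exists n.
have phiN n : osg N n -> osg N (phi n).
  move=> Nn; apply: (closed_cvg (osg N) (@osg_closed N) _ (phi n) (cphi n)).
  by apply: nearW => f; exact: aN.
have near_s : \forall f \near F, forall x, x \in s -> osg N ((phi x)^-1 * a f x).
  elim: s {sP} => [|x s IH]; first by apply: nearW.
  have : \forall f \near F, osg N ((phi x)^-1 * a f x).
    have : nbhs (phi x) ((fun y => (phi x)^-1 * y) @^-1` osg N).
      by apply: continuous_lmulg; rewrite mulVg; exact: osg_nbhs1.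
    exact: cphi.
  apply: filterS2 IH => f fs fx y; rewrite inE => /orP[/eqP->//|]; exact: fs.
apply: filterS near_s => f fs y.
have [x xs [n Nn <-]] := sP y I.
rewrite phiM tisoM invgM mulgA; apply: osgM; last exact: aN.
rewrite -mulgA; apply: osgM; last exact: fs.
by apply: osgV; exact: phiN.
Qed.

(** Along an ultrafilter, $f$ and $f^{-1}$ converge pointwise. Characteristic subgroups make both
    convergences uniform, so the limits are continuous, inverse to each other, and limits for the
    topology of [Aut V]. *)
Lemma Aut_compact : compact [set: Aut V].
Proof.
rewrite compact_ultra => F FU _.
have FF : ProperFilter F by exact: ultra_proper.
have [phi cphi] := choice (fun x : V => ultra_map_cvg (fun f : Aut V => f x) cV FU).
have [psi cpsi] := choice (fun x : V => ultra_map_cvg (fun f : Aut V => f^-1 x) cV FU).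
have uphi N cN := aut_limit_uniform (a := id) (N := N) FF cphi cN.
have upsi N cN := aut_limit_uniform (a := fun f => f^-1) (N := N) FF cpsi cN.
have contl (a : Aut V -> Aut V) (th : V -> V) :
    (forall N : openSubgroup V, characteristic (osg N) ->
      \forall f \near F, forall x, osg N ((th x)^-1 * a f x)) ->
    {morph th : x y / x * y} -> continuous th.
  move=> uth thM x A /= thA.
  have /bV[N Nchar NA] : nbhs 1 ((fun y => th x * y) @^-1` A).
    by apply: continuous_lmulg; rewrite mulg1.
  have [f fN] := filter_ex (uth N Nchar).
  have := nbhs_lmulg x (osg_nbhs1 N); rewrite mulg1; apply: filterS => _ [n Nn <-] /=.
  rewrite thM; apply: NA.
  rewrite -[th n]invgK; apply: osgV; rewrite -(mulgK (a f n) (th n)^-1).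
  apply: osgM; first exact: fN.
  by apply: osgV; rewrite -(Nchar (a f)); exists n.
have phiM := aut_limit_morph (a := id) FF cphi.
have psiM := aut_limit_morph (a := fun f => f^-1) FF cpsi.
(* Modulo a characteristic [N], [et (th x)] agrees with [b f (th x)], and this with
   [b f (a f x) = x]. *)
have limK (a b : Aut V -> Aut V) (th et : V -> V) :
    (forall N : openSubgroup V, characteristic (osg N) ->
      \forall f \near F, forall x, osg N ((th x)^-1 * a f x)) ->
    (forall N : openSubgroup V, characteristic (osg N) ->
      \forall f \near F, forall x, osg N ((et x)^-1 * b f x)) ->
    (forall f x, b f (a f x) = x) -> cancel th et.
  move=> uth uet abK x; rewrite -[LHS]invgK; apply: mulg1_eq.
  apply: char_basedP => N cN.
  have [f [f1 f2]] := filter_ex (filterI (uth N cN) (uet N cN)).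
  have -> : (et (th x))^-1 * x =
      ((et (th x))^-1 * b f (th x)) * ((b f (th x))^-1 * x).
    by rewrite mulgA mulgK.
  apply: osgM; first exact: f2.
  rewrite -(cN (b f)); exists ((th x)^-1 * a f x); first exact: f1.
  by rewrite tisoM abK (homV (@tisoM _ _ _)).
have phiK : cancel phi psi by apply: limK uphi upsi _ => f x; exact: autK.
have psiK : cancel psi phi by apply: limK upsi uphi _ => f x; exact: autVK.
pose th : Aut V := @TopIso V V phi psi phiM phiK psiK (contl _ _ uphi phiM) (contl _ _ upsi psiM).
exists th; split=> // S /nbhs_autE[O OS].
have [N cN NO] := bV (osg_nbhs1 O).
apply: filterS (uphi N cN) => f fN.
(* The congruence for $f\,th^{-1}$ at [x] is the one between [f] and [phi] at [psi x]. *)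
rewrite -(mulgVK th f); apply: OS => x.
apply: NO; rewrite autM.
by have := fN (psi x); rewrite psiK.
Qed.

End AutCompact.

(** * Restriction of automorphisms to an open subgroup *)

Section RestrictAut.
Context (U L : topGroupType) (e : U -> L) (he : open_embedding e).

Lemma restrict_aut (psi : Aut L) :
  (forall u, range e (psi (e u))) -> (forall u, range e (psi^-1 (e u))) ->
  exists gam : Aut U, forall u, e (gam u) = psi (e u).
Proof.
move=> eV eV'; have /choice[k ek] u := emb_lift (eV u).
have /choice[k' ek'] u := emb_lift (eV' u).
have kM : {morph k : x y / x * y}.
  by move=> x y; apply: (emb_inj he); rewrite (embM he) !ek (embM he) tisoM.
have kK : cancel k k'.
  by move=> x; apply: (emb_inj he); rewrite ek' ek autK.
have k'K : cancel k' k.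
  by move=> x; apply: (emb_inj he); rewrite ek ek' autVK.
have ck : continuous k.
  apply: (emb_continuousP he) => x.
  rewrite (_ : e \o k = psi \o e); last by apply/funext => u /=.
  by apply: continuous_comp; [exact: (emb_continuous he)|exact: tiso_continuous].
have ck' : continuous k'.
  apply: (emb_continuousP he) => x.
  rewrite (_ : e \o k' = tiso_inv psi \o e); last by apply/funext => u /=.
  by apply: continuous_comp; [exact: (emb_continuous he)|exact: tiso_inv_continuous].
by exists (TopIso kM kK k'K ck ck').
Qed.

End RestrictAut.

(** * Extension by rigidity and its behaviour near $1$ *)

Section Extension.
Context (L V : topGroupType) (e : V -> L) (he : open_embedding e).

Lemma emb_range_subgroup : is_subgroup (range e).
Proof.
apply/is_subgroupE; split; first by exists 1 => //; exact: (hom1 (embM he)).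
move=> _ _ [x _ <-] [y _ <-]; exists (x * y^-1) => //.
by rewrite (embM he) (homV (embM he)).
Qed.

Definition emb_range : openSubgroup L :=
  OpenSubgroup emb_range_subgroup (emb_open he openT).

Context (cV : compact [set: V]) (rigidL : rigid L).

(** Rigidity speaks of subgroups of [L], so [g] is first transported to the range of [e]. The
    equivalence packs existence and uniqueness: identities such as [extM] need only be checked on
    the range. *)
Lemma rigid_ext : exists ext : Aut V -> Aut L, forall (g : Aut V) (psi : Aut L),
  (forall v, psi (e v) = e (g v)) <-> psi = ext g.
Proof.
suff /choice[ext extP] (g : Aut V) : exists psi : Aut L, forall psi' : Aut L,
    (forall v, psi' (e v) = e (g v)) <-> psi' = psi by exists ext.
have /choice[k ek] (y : emb_range) : exists v, e v = val y.
  exact/emb_lift/set_mem/(valP y).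
pose i v : emb_range := exist _ (e v) (mem_set (imageT e v)).
have ci : continuous i by apply: osg_continuousP; exact: (emb_continuous he).
have ck : continuous k.
  apply: (emb_continuousP he) => x.
  by rewrite (_ : e \o k = val); [exact: osg_val_continuous|apply/funext => y /=].
have ki : cancel i k by move=> v; apply: (emb_inj he); rewrite ek.
have ik : cancel k i by move=> y; apply: val_inj; rewrite /= ek.
have iM : {morph i : x y / x * y} by move=> x y; apply: val_inj; exact: (embM he).
have kM : {morph k : x y / x * y}.
  by move=> x y; apply: (can_inj ki); rewrite iM !ik.
have fM : {morph (i \o g \o k) : x y / x * y}.
  by move=> x y /=; rewrite kM tisoM iM.
have fK : cancel (i \o g \o k) (i \o tiso_inv g \o k) by move=> y /=; rewrite ki tisoK ik.
have fVK : cancel (i \o tiso_inv g \o k) (i \o g \o k) by move=> y /=; rewrite ki tiso_invK ik.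
have cf (h : Aut V) : continuous (i \o h \o k).
  move=> y; apply: continuous_comp; first exact: ck.
  by apply: continuous_comp; [exact: tiso_continuous|exact: ci].
have ce : compact (osg emb_range).
  apply: continuous_compact => //.
  by apply: continuous_subspaceT; exact: (emb_continuous he).
have [psi [psiE psiU]] := rigidL (TopIso fM fK fVK (cf g) (cf g^-1)) ce ce.
exists psi => psi'; split=> [psi'E|-> v].
  by apply/esym/psiU => y /=; rewrite -psi'E ek.
by rewrite -[e v]/(val (i v)) psiE /= ki.
Qed.

Context (hV : hausdorff_space V) (bV : char_based V) (VZL : VZ L = [set 1]).
Context (ext : Aut V -> Aut L)
  (extP : forall (g : Aut V) (psi : Aut L), (forall v, psi (e v) = e (g v)) <-> psi = ext g).

Lemma extE (g : Aut V) v : ext g (e v) = e (g v).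
Proof. by move: v; apply/extP. Qed.

Lemma extM (f g : Aut V) : ext (f * g) = ext f * ext g.
Proof. by apply/esym/extP => v; rewrite autM !extE. Qed.

Lemma ext1 : ext 1 = 1.
Proof. exact: (hom1 extM). Qed.

Lemma extK (g : Aut V) x : ext g^-1 (ext g x) = x.
Proof. by rewrite -autM -extM mulVg ext1. Qed.

(* As the centralizer of any open subgroup is trivial, [ext g x = y * e v] can be
   tested on the elements of an open subgroup that [x] conjugates into the range
   of [e]: this only involves the values of [g] on [V]. *)
Lemma ext_cosetP (g : Aut V) x y v :
  (forall w w', e w' = x * e w * x^-1 ->
     e (g w') = (y * e v) * e (g w) * (y * e v)^-1) <->
  ext g x = y * e v.
Proof.
split=> [gx|<- w w' ww']; last first.
  by rewrite -!extE ww' !tisoM (homV (@tisoM _ _ _)).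
suff : VZ L ((y * e v)^-1 * ext g x).
  by rewrite VZL => /= /mulg1_eq; rewrite invgK.
apply/VZP; pose A := e @^-1` [set z | range e (x * z * x^-1)].
have A1 : nbhs 1 A.
  have cJ : continuous (fun z => x * z * x^-1).
    by apply: continuous_mulg; [exact: continuous_lmulg|exact: cst_continuous].
  apply: (emb_continuous he); apply: cJ.
  by rewrite (hom1 (embM he)) mulg1 mulgV; exact: (osg_nbhs1 emb_range).
exists (e @` (tiso_inv g @^-1` A)).
  rewrite -(hom1 (embM he)); apply: (emb_nbhs he).
  by apply: (@tiso_continuous _ _ g^-1); rewrite (hom1 (@tisoM _ _ g^-1)).
move=> _ [u [w' _ ew'] <-].
have := gx _ _ ew'; rewrite autVK -extE ew' !tisoM (homV (@tisoM _ _ _)) extE autVK.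
move=> E; apply: (mulgI (y * e v)); apply: (mulIg (ext g x)^-1).
rewrite !mulgA in E *; by rewrite mulgV mul1g mulgK E.
Qed.

(** By [ext_cosetP], the pairs [(g, v)] with [ext g x = y * e v] form a closed subset [R] of the
    compact space [Aut V * V]. The set in question is its projection to the Hausdorff space
    [Aut V]. *)
Lemma ext_coset_closed x y : closed [set g | exists v, ext g x = y * e v].
Proof.
pose c (p : Aut V * V) (w : V * V) :=
  (y * e p.2) * e (p.1 w.1) * (y * e p.2)^-1 * (e (p.1 w.2))^-1.
pose R := \bigcap_(w in [set w : V * V | e w.2 = x * e w.1 * x^-1])
            [set p : Aut V * V | c p w = 1].
have hL : hausdorff_space L by exact: (emb_hausdorff he hV).
have ceval w : continuous (fun p : Aut V * V => e (p.1 w)).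
  move=> p; apply: (@continuous_comp _ _ _ (fun p : Aut V * V => p.1 w) e).
    apply: (@continuous_comp _ _ _ fst (fun g : Aut V => g w)); first exact: cvg_fst.
    exact: continuous_eval.
  exact: (emb_continuous he).
have cye : continuous (fun p : Aut V * V => y * e p.2).
  apply: continuous_mulg; first exact: cst_continuous.
  by move=> p; apply: continuous_comp; [exact: cvg_snd|exact: (emb_continuous he)].
have cR : closed R.
  apply: closed_bigI => w _; apply: (@preimage_closed _ _ (c^~ w) [set 1]).
    move=> p _; do !apply: continuous_mulg => //; exact: continuous_invg.
  exact/accessible_closed_set1/hausdorff_accessible.
suff -> : [set g | exists v, ext g x = y * e v] = fst @` R.
  apply: compact_closed; first exact: Aut_hausdorff.
  apply: continuous_compact; first by apply: continuous_subspaceT => p; exact: cvg_fst.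
  apply: (subclosed_compact cR (compact_setX (Aut_compact cV hV bV) cV)).
  by move=> p _.
apply/seteqP; split=> [g [v /ext_cosetP gv]|_ [[g v] Rgv <-]].
  by exists (g, v) => // -[w w'] /= /gv gww'; rewrite /c /= -gww' mulgV.
exists v; apply/ext_cosetP => w w' ww'.
by have /divg1_eq <- := Rgv (w, w') ww'.
Qed.

(** [L] is the union of the compact sets [P n] of products of [n] generators or inverses of
    generators, and finitely many open cosets cover each [P n]. *)
Lemma countable_cosets : compactly_generated L ->
  exists D : nat -> L, forall z, exists n v, z = D n * e v.
Proof.
move=> [K cK genK].
pose K' := K `|` (fun x => x^-1) @` K.
have cinv : continuous (fun x : L => x^-1) by exact: invg_continuous.
have cK' : compact K'.
  by apply: compactU => //; apply: continuous_compact => //; exact: continuous_subspaceT.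
pose P := fix P n := if n is m.+1
  then (fun x : L * L => x.1 * x.2) @` (P m `*` K') else [set 1].
have cP n : compact (P n).
  elim: n => [|n IH]; first exact: compact_set1.
  apply: continuous_compact; first by apply: continuous_subspaceT; exact: mulg_continuous.
  exact: compact_setX.
have PK' n x y : P n x -> K' y -> P n.+1 (x * y) by exists (x, y).
have K'V x : K' x -> K' x^-1.
  by move=> [Kx|[y Ky <-]]; [right; exists x|left; rewrite invgK].
have HT : \bigcup_n P n = setT.
  apply: genK.
    apply/is_subgroupE; split; first by exists 0.
    (* The induction takes the last letter off [y] and appends its inverse to [x], which raises [m]
       by one. *)
    move=> x y [m _ Px] [n _]; elim: n x y m Px => [|n IH] x y m Px.
      by move=> /= ->; exists m => //; rewrite invg1 mulg1.
    move=> [[a b] /= [Pa Kb] <-]; rewrite invgM mulgA.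
    by apply: (IH _ _ m.+1) => //; apply: PK' => //; exact: K'V.
  move=> x Kx; exists 1%N => //; rewrite -[x]mul1g.
  by apply: PK' => //; left.
have /choice[s sP] n : exists s : seq L, forall y, P n y ->
    exists2 x, x \in s & [set x * e v | v in setT] y.
  by apply: compact_nbhs_cover => // x _; apply: (emb_coset_nbhs he); exact: filterT.
(* Both defaults $1$ only repeat a coset. *)
exists (fun m => if unpickle m is Some (n, k) then nth 1 (s n) k else 1) => z.
have [n _ Pnz] : (\bigcup_n P n) z by rewrite HT.
have [x xs [v _ <-]] := sP n z Pnz.
by exists (pickle (n, index x (s n))), v; rewrite pickleK nth_index.
Qed.

(** Baire's theorem gives an [f] such that [ext h x] stays in one coset for [h] near [f]. Then
    [ext h x] and [ext f x] differ by a right factor in the range of [e], and applying [ext f^-1]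
    carries this over to $f^{-1}h$, which is near $1$. *)
Lemma ext_coset_nbhs (cg : compactly_generated L) x :
  \forall g \near (1 : Aut V), exists v, ext g x = x * e v.
Proof.
have [D DP] := countable_cosets cg.
have [n [f fC]] : exists n, [set g | exists v, ext g x = D n * e v]° !=set0.
  apply: compact_baire; [exact: Aut_compact|exact: Aut_hausdorff|by exists 1| |].
    by move=> n; exact: ext_coset_closed.
  by move=> g; exact: DP.
have := nbhs_lmulg f^-1 fC; rewrite mulVg; apply: filterS => _ [h [v hv] <-].
have [v0 fv0] := nbhs_singleton fC.
exists (f^-1 (v0^-1 * v)); rewrite extM autM hv -extE -[in RHS](extK f x) fv0 -tisoM.
by rewrite (embM he) (homV (embM he)) !mulgA mulgK.
Qed.

(** Finitely many cosets of the range cover [M], and for [g] near $1$ each representative [x] stays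
    in its coset. So does [x * e v], since its image is [ext g x * e (g v)]. *)
Lemma ext_stable_nbhs (cg : compactly_generated L) (M : set L) :
  compact M -> (forall x v, M x -> M (x * e v)) ->
  \forall g \near (1 : Aut V), forall x, M x -> M (ext g x).
Proof.
move=> cM Me.
have [|s sP] := @compact_nbhs_cover L M (fun x => [set x * e v | v in setT]) cM.
  by move=> x _; apply: (emb_coset_nbhs he); exact: filterT.
have : \forall g \near (1 : Aut V), forall x, x \in s -> exists v, ext g x = x * e v.
  elim: s {sP} => [|x s IH]; first by apply: filterE => g x; rewrite in_nil.
  apply: filterS2 IH (ext_coset_nbhs cg x) => g gs gx y.
  by rewrite inE => /orP[/eqP->//|]; exact: gs.
apply: filterS => g gs y My; have [x xs [v _ xv]] := sP y My.
have [v' xv'] := gs x xs.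
have -> : ext g y = y * e (v^-1 * v' * g v).
  by rewrite -xv tisoM xv' extE !(embM he) (homV (embM he)) !mulgA mulgK.
exact: Me.
Qed.

End Extension.

(** * Open subgroups and a criterion for Aut-stability *)

Section ProfiniteGroup.
Context (G : topGroupType).
Implicit Types U V : openSubgroup G.

Lemma osgP U (x : U) : osg U (val x).
Proof. exact/set_mem/valP. Qed.

Lemma osg_embedding U : open_embedding (val : U -> G).
Proof.
split; [by []|exact: val_inj|exact: osg_val_continuous|].
move=> x A; rewrite nbhsE => -[_ [[B oB <-] Bx] BA].
have : nbhs (val x) (B `&` osg U).
  by apply: filterI; apply: open_nbhs_nbhs; split=> //; [exact: osg_open|exact: osgP].
apply: filterS => y [By Uy]; exists (exist _ y (mem_set Uy)) => //.
exact: BA.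
Qed.

Lemma osg_compact U : compact [set: G] -> compact [set: U].
Proof.
move=> cG; have cU : compact (osg U).
  by apply: (subclosed_compact (@osg_closed G U) cG).
move=> F FF _.
have [p [Up clp]] := cU _ (fmap_proper_filter (val : U -> G) FF)
  (filterE _ (@osgP U)).
exists (exist _ p (mem_set Up)); split=> // A B FA pB.
have vA : F (val @^-1` (val @` A)) by apply: filterS FA => u Au; exists u.
have [_ [[u Au <-] [v Bv /val_inj vu]]] := clp _ _ vA (emb_nbhs (osg_embedding U) pB).
by exists u; split=> //; rewrite -vu.
Qed.

Lemma osg_hausdorff U : hausdorff_space G -> hausdorff_space U.
Proof.
move=> hG p q pq; apply: val_inj; apply: hG => A B pA qB.
have [u [Au Bu]] := pq _ _ (osg_val_continuous pA) (osg_val_continuous qB).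
by exists (val u).
Qed.

(** If [f] fixes both $n$ and $gng^{-1}$, then $f(g)nf(g)^{-1}=gng^{-1}$, so $g^{-1}f(g)$ commutes
    with $n$. This holds for all $n$ near $1$. *)
Lemma TAut_trivial U : VZ G = [set 1] -> TAut U = [set 1].
Proof.
move=> GVZ; apply/seteqP; split=> [f [O fO]|_ ->]; last by exists (osgT U).
apply: topIso_ext => g.
suff : VZ G (val (g^-1 * f g)).
  rewrite GVZ => /= c1; have /mulg1_eq : g^-1 * f g = 1 by exact: val_inj.
  by rewrite invgK => <-.
apply/VZP; exists (val @` [set n : U | osg O n /\ osg O (g * n * g^-1)]).
  rewrite -[1]/(val (1 : U)); apply: (emb_nbhs (osg_embedding U)).
  have cJ : continuous (fun n : U => g * n * g^-1).
    by apply: continuous_mulg; [exact: continuous_lmulg|exact: cst_continuous].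
  apply: filterI; first exact: osg_nbhs1.
  by apply: cJ; rewrite mulg1 mulgV; exact: osg_nbhs1.
move=> _ [n [On Ogn] <-]; rewrite /commute -!(embM (osg_embedding U)); congr val.
have := fO _ Ogn; rewrite !tisoM (homV (@tisoM _ _ f)) (fO n On) => E.
apply: (mulgI g); apply: (mulIg (f g)^-1).
by rewrite !mulgA mulgV mul1g E mulgK.
Qed.

(** If [al] in [Aut_fix U V] has the class of [be], and [g] near $1$ in [Aut V] extends to [gam] on
    [U], then [gam * al] has the class of [g * be]. So a whole neighbourhood of [be] has its classes
    in [uAut_fix U V]. *)
Lemma Aut_stable_near U :
  (forall V, osg V `<=` osg U -> \forall g \near (1 : Aut V),
     exists gam : Aut U, forall (u : U) (v : V), val u = val v :> G ->
       val (gam u) = val ((g : Aut V) v) :> G) ->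
  Aut_stable U.
Proof.
move=> near_ext V VU.
pose i (v : V) : U := exist _ (val v) (mem_set (VU _ (osgP v))).
have fixP (al : Aut U) (be : Aut V) :
    (forall (u : U) (v : V), val u = val v :> G -> val (al u) = val (be v) :> G) ->
    Aut_fix U V al.
  move=> albe; apply/seteqP; split=> [_ [u Vu <-]|u Vu] /=.
    by rewrite (albe u (exist _ (val u) (mem_set Vu)))//; exact: osgP.
  pose v : V := exist _ (val u) (mem_set Vu).
  exists (i (be^-1 v)); first exact: (osgP (be^-1 v)).
  by apply: val_inj; rewrite (albe _ (be^-1 v))// autVK.
have rho_eq (al : Aut U) (be : Aut V) (W : openSubgroup G) : osg W `<=` osg V ->
    (forall (u : U) (v : V), osg W (val v) ->
       val u = val v :> G -> val (al u) = val (be v) :> G) ->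
    rho U al = rho V be.
  move=> WV albe; apply/eqmodP/asboolP; exists W; split=> //.
    by move=> x /WV /VU.
  move=> u v Wu uv; apply: albe => //.
  by have : osg W (val u) := Wu; rewrite uv.
have iE : open_embedding i.
  split.
  - by move=> x y; apply: val_inj.
  - by move=> x y /(congr1 (val : U -> G)) ixy; apply: val_inj.
  - by apply: osg_continuousP; exact: osg_val_continuous.
  move=> x A /(emb_nbhs (osg_embedding V)) xA.
  have : nbhs (i x) (val @^-1` (val @` A)) by exact: osg_val_continuous.
  by apply: filterS => u [v Av vu]; exists v => //; apply: val_inj.
have ri (u : U) : (val @^-1` osg V : set U) u -> range i u.
  by move=> Vu; exists (exist _ (val u) (mem_set Vu)) => //; apply: val_inj.
have Vi (v : V) : (val @^-1` osg V : set U) (i v) by exact: osgP.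
split.
  (* The restriction of [al] to [V] is an automorphism of [V] with the same class. *)
  move=> _ [al Val <-].
  have [v|v|be beE] := restrict_aut iE (psi := al).
  - by apply: ri; rewrite /Aut_fix /= in Val; rewrite -Val; exists (i v).
  - apply: ri; have := Vi v; rewrite -{1}Val => -[u Vu <-].
    by rewrite autK.
  exists be => //; apply/esym/(rho_eq al be V) => // u v Vv uv.
  by rewrite -[val (be v)]/(val (i (be v))) beE; congr (val (al _)); apply: val_inj.
rewrite openE => be [al Val rho_al].
have /eqmodP/asboolP[W [/= WU WV Weq]] := rho_al.
have /nbhs_autE[O Oext] := near_ext V VU.
apply/nbhs_autE; exists O => g /Oext[gam]; rewrite mulg1 => gamE.
exists (gam * al).
  have Vgam := fixP _ _ gamE; rewrite /Aut_fix /= in Val Vgam *.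
  by rewrite -[LHS](image_comp al gam) Val Vgam.
apply: (rho_eq _ _ W) => // u v Wv uv; rewrite !autM; apply: gamE.
by apply: Weq => //; rewrite uv.
Qed.

End ProfiniteGroup.

(** * Envelopes of [G] *)

Lemma envelope_embedding (G : topGroupType) (L : envelope G) :
  open_embedding (@env_map G L).
Proof.
have [g [gK ce cg]] := env_map_homeo L.
split; [exact: env_mapM|exact: env_map_inj|exact: ce|].
move=> x A xA; have oR := env_map_open L.
have gx : nbhs (env_map L x) (g @^-1` A).
  move: cg; rewrite continuous_open_subspace// => cg.
  by apply: cg; [rewrite inE; exists x|rewrite gK].
have : nbhs (env_map L x) (range (@env_map G L)).
  by apply: open_nbhs_nbhs; split => //; exists x.
move: gx; apply: filterS2 => z /= gA [y _ ey]; exists y => //.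
by rewrite -ey gK in gA.
Qed.

Section Main.
Context (G : topGroupType) (Gprof : profinite G)
  (Gbased : hereditarily_countably_char_based G) (GVZ : VZ G = [set 1]).

(** [TAut U] is a single point of a Hausdorff space. *)
Lemma VZ1_Aut1 : Aut1 G.
Proof.
move=> U; rewrite (TAut_trivial U GVZ).
have [cG hG _] := Gprof.
apply/accessible_closed_set1/hausdorff_accessible/Aut_hausdorff.
  exact: osg_hausdorff.
exact/countably_char_based_char_based/Gbased.
Qed.

(** [VZ L] is closed and normal, so it is trivial or all of [L]; in the second case [VZ G] is all of
    [G]. *)
Lemma envelope_VZ (L : envelope G) : topologically_simple L ->
  VZ L = [set 1] \/ forall x : G, x = 1.
Proof.
have [cG hG _] := Gprof; have LE := envelope_embedding L.
move=> [_ simL].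
have [|VT] := simL _ (VZ_emb_closed LE hG GVZ) (VZ_normal L); first by left.
right=> x; suff : VZ G x by rewrite GVZ.
by apply: (VZ_emb LE); rewrite VT.
Qed.

Lemma envelope_Aut_stable (L : envelope G) (U : openSubgroup G) :
  compactly_generated L -> topologically_simple L -> rigid L -> Aut_stable U.
Proof.
move=> cgL simL rigL; have [cG hG _] := Gprof; have LE := envelope_embedding L.
apply: Aut_stable_near => V VU.
have [VZL|G1] := envelope_VZ simL; last first.
  (* When [G] is trivial the identity extends every [g]. *)
  apply: filterE => g; exists 1 => u v _.
  by rewrite (G1 (val _)) [RHS]G1.
have embL (W : openSubgroup G) : open_embedding (@env_map G L \o (val : W -> G)).
  have WE := osg_embedding W; split.
  - by move=> x y; rewrite /= (embM LE).
  - by move=> x y /= /(emb_inj LE)/val_inj.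
  - by move=> x; apply: continuous_comp; [exact: (emb_continuous WE)|exact: (emb_continuous LE)].
  - by move=> x A /(emb_nbhs WE)/(emb_nbhs LE); rewrite image_comp.
have bV : char_based V by exact/countably_char_based_char_based/Gbased.
have cV := osg_compact (U := V) cG; have hV := osg_hausdorff (U := V) hG.
have [ext extP] := rigid_ext (embL V) cV rigL.
(* The image of [U] is compact and, as [V] lies in [U], a union of cosets of the image of [V]. *)
pose M : set L := range (@env_map G L \o (val : U -> G)).
have cM : compact M.
  apply: continuous_compact; last exact: osg_compact.
  by apply: continuous_subspaceT; exact: (emb_continuous (embL U)).
have MV x (v : V) : M x -> M (x * (@env_map G L \o val) v).
  move=> [u _ <-]; pose w : U := exist _ (val v) (mem_set (VU _ (osgP v))).
  by exists (u * w) => //; rewrite (embM (embL U)).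
have Mext := ext_stable_nbhs (embL V) cV hV bV VZL extP cgL cM MV.
(* Stability under the inverse as well makes [ext g] restrict to an automorphism of [U]. *)
have MextV : \forall g \near (1 : Aut V), forall x, M x -> M (ext g^-1 x).
  have : nbhs (1^-1 : Aut V) [set g : Aut V | forall x, M x -> M (ext g x)].
    by rewrite invg1.
  exact: invg_continuous.
apply: filterS2 Mext MextV => g Mg MgV.
have [u|u|gam gamE] := restrict_aut (embL U) (psi := ext g).
- exact: (Mg _ (imageT _ u)).
- by rewrite -(homV (extM extP)); exact: (MgV _ (imageT _ u)).
exists gam => u v uv; apply: (emb_inj LE).
have := gamE u; rewrite /= uv => ->.
exact: (extE extP g v).
Qed.

End Main.

Theorem proposition8p13 (G : topGroupType)
  (Gprof : profinite G)
  (Gbased : hereditarily_countably_char_based G)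
  (GVZ : VZ G = [set 1])
  (GnAut2 : ~ Aut2 G) :
  ~ exists L : envelope G,
      [/\ compactly_generated L, topologically_simple L & rigid L].
Proof.
move=> [L [cgL simL rigL]]; apply: GnAut2; split; first exact: VZ1_Aut1.
by exists (osgT G); exact: (envelope_Aut_stable Gprof Gbased GVZ cgL simL rigL).
Qed.
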